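(* Let $k$ be a field. For any atomless Boolean algebra $\mathbb{B}$, the frame $\mathrm{IdemIdl}(\mathfrak{R}(\mathbb{B}))$ of idempotent ideals in the nil-Cantor ring $\mathfrak{R}(\mathbb{B})$ over $k$ has cardinality $\geq|\mathbb{B}|$, but has exactly one point: $\mathrm{pt}(\mathrm{IdemIdl}(\mathfrak{R}(\mathbb{B})))=\{\ast\}$. In particular, if $\mathbb{B}$ is nontrivial (that is, $0\neq 1$ in $\mathbb{B}$), then $\mathrm{IdemIdl}(\mathfrak{R}(\mathbb{B}))$ is not spatial.
   Context: A frame is a complete lattice in which finite meets distribute over arbitrary joins. A frame homomorphism preserves finite meets (including top) and arbitrary joins (including bottom). A point of a frame $L$ is a frame homomorphism $p\colon L\to\{0<1\}$, and $\mathrm{pt}(L)$ is the set of points. $L$ is spatial if whenever $a\nleq b$ there is a point $p$ with $p(a)=1$ and $p(b)=0$. For a commutative ring $A$, $\mathrm{IdemIdl}(A)$ is the poset, under inclusion, of ideals $I$ with $I^2=I$; it is a frame with joins $\bigvee_\alpha I_\alpha=\sum_\alpha I_\alpha$ and binary meets $I\wedge J=IJ$. An atom of a Boolean algebra is a minimal nonzero element; a Boolean algebra is atomless if it has no atoms. Nil-Cantor ring: for a Boolean algebra $\mathbb{B}$, $\mathfrak{R}(\mathbb{B})$ is the commutative $k$-algebra with $k$-basis $\{e_b\mid b\in\mathbb{B}\}$ and $k$-bilinear multiplication determined by $e_b\cdot e_c=e_{b\vee c}$ if $b\wedge c=0$ and $e_b\cdot e_c=0$ otherwise; its unit is $e_0$.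 *)

(* Defs.v *)
From HB Require Import structures.
From mathcomp Require Import all_boot all_order all_algebra finmap.
From mathcomp Require Import boolp classical_sets functions cardinality.
From mathcomp Require Import monalg.

Set Implicit Arguments.
Unset Strict Implicit.
Unset Printing Implicit Defensive.

Import Order.TTheory GRing.Theory.

Local Open Scope classical_set_scope.
Local Open Scope ring_scope.

(** * Frames, points, spatiality *)

(* Arbitrary meets need not be part of the structure: the meet of [S] is the
   join of its lower bounds. *)
HB.mixin Record TBLattice_isFrame d L of Order.TBLattice d L := {
  frame_join : set L -> L;
  frame_join_ub : forall (S : set L) x, S x -> (x <= frame_join S)%O;
  frame_join_le : forall (S : set L) y,
    (forall x, S x -> (x <= y)%O) -> (frame_join S <= y)%O;
  meet_frame_join : forall x (S : set L),
    (x `&` frame_join S)%O = frame_join [set (x `&` y)%O | y in S]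
}.

#[short(type="frameType")]
HB.structure Definition Frame d :=
  { L of Order.TBLattice d L & TBLattice_isFrame d L }.

Section BoolFrame.
Implicit Types (S : set bool) (x y : bool).

Definition bool_frame_join S : bool := `[< S true >].

Fact bool_frame_join_ub S x : S x -> (x <= bool_frame_join S)%O.
Proof. by case: x => // St; rewrite /bool_frame_join asboolT. Qed.

Fact bool_frame_join_le S y :
  (forall x, S x -> (x <= y)%O) -> (bool_frame_join S <= y)%O.
Proof. by move=> Sy; rewrite /bool_frame_join; case: asboolP => [/Sy|]. Qed.

Fact bool_meet_frame_join x S :
  (x `&` bool_frame_join S)%O = bool_frame_join [set (x `&` y)%O | y in S].
Proof.
rewrite /bool_frame_join; apply/idP/idP.
  by case: x => // /asboolP St; apply/asboolP; exists true.
by move=> /asboolP[[] Sy]; case: x => // _; apply/asboolP.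
Qed.

HB.instance Definition _ := TBLattice_isFrame.Build _ bool
  bool_frame_join_ub bool_frame_join_le bool_meet_frame_join.
End BoolFrame.

(* Preservation of the bottom element is the case [S = set0] of the last
   clause. *)
Definition frame_hom d (L : frameType d) d' (M : frameType d') (f : L -> M) :
    Prop :=
  [/\ f \top%O = \top%O,
      forall x y, f (x `&` y)%O = (f x `&` f y)%O
    & forall S : set L, f (frame_join S) = frame_join (f @` S)].

(* [bool], with [false < true], is the two-element frame. *)
Definition pt d (L : frameType d) : set (L -> bool) := [set p | frame_hom p].
Arguments pt {d} L _.

Definition spatial d (L : frameType d) : Prop :=
  forall a b : L, ~~ (a <= b)%O -> exists p, [/\ pt L p, p a = true & p b = false].
Arguments spatial {d} L.

(** * Idempotent ideals of a commutative ring *)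

Section Ideals.
Variable A : comPzRingType.
Implicit Types (S I J K : set A) (F : set (set A)).

Definition is_ideal I : Prop :=
  [/\ I 0, forall x y, I x -> I y -> I (x + y) & forall a x, I x -> I (a * x)].

Definition finite_sums S : set A :=
  [set x | exists2 s : seq A, (forall y, y \in s -> S y) & x = \sum_(y <- s) y].

Definition ideal_mul I J : set A :=
  finite_sums [set z | exists x y, [/\ I x, J y & z = x * y]].

Definition ideal_sum F : set A := finite_sums (\bigcup_(I in F) I).

Lemma finite_sums0 S : finite_sums S 0.
Proof. by exists [::]; rewrite ?big_nil. Qed.

Lemma finite_sumsD S x y :
  finite_sums S x -> finite_sums S y -> finite_sums S (x + y).
Proof.
move=> [s Ss ->] [t St ->]; exists (s ++ t); last by rewrite big_cat.
by move=> z; rewrite mem_cat => /orP[/Ss|/St].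
Qed.

Lemma finite_sums_incl S : S `<=` finite_sums S.
Proof.
move=> x Sx; exists [:: x]; last by rewrite big_seq1.
by move=> y; rewrite inE => /eqP ->.
Qed.

Lemma finite_sums_min S (T : set A) :
  T 0 -> (forall x y, T x -> T y -> T (x + y)) -> S `<=` T ->
  finite_sums S `<=` T.
Proof.
move=> T0 TD ST x [s Ss ->]; rewrite big_seq.
by elim/big_ind: _ => // y /Ss /ST.
Qed.

Lemma is_ideal_finite_sums S :
  (forall a x, S x -> S (a * x)) -> is_ideal (finite_sums S).
Proof.
move=> SM; split; [exact: finite_sums0 | exact: finite_sumsD|].
move=> a; apply: (@finite_sums_min S [set x | finite_sums S (a * x)]) => /=.
- by rewrite mulr0; exact: finite_sums0.
- by move=> x y Sx Sy; rewrite mulrDr; exact: finite_sumsD.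
- by move=> x Sx; exact/finite_sums_incl/SM.
Qed.

Lemma is_ideal_mul I J : is_ideal I -> is_ideal (ideal_mul I J).
Proof.
move=> [_ _ IM]; apply: is_ideal_finite_sums => a _ [x [y [Ix Jy ->]]].
by exists (a * x), y; rewrite mulrA; split=> //; exact: IM.
Qed.

Lemma is_ideal_sum F :
  (forall I, F I -> is_ideal I) -> is_ideal (ideal_sum F).
Proof.
move=> Fid; apply: is_ideal_finite_sums => a x [I FI Ix].
by exists I => //; have [_ _] := Fid _ FI; apply.
Qed.

Lemma mem_ideal_mul I J x y : I x -> J y -> ideal_mul I J (x * y).
Proof. by move=> Ix Jy; apply: finite_sums_incl; exists x, y. Qed.

Lemma ideal_mul_min I J K : is_ideal K ->
  (forall x y, I x -> J y -> K (x * y)) -> ideal_mul I J `<=` K.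
Proof.
move=> [K0 KD _] IJK; apply: finite_sums_min => // _ [x [y [Ix Jy ->]]].
exact: IJK.
Qed.

Lemma ideal_sum_min F K : is_ideal K ->
  (forall I, F I -> I `<=` K) -> ideal_sum F `<=` K.
Proof.
by move=> [K0 KD _] FK; apply: finite_sums_min => // x [I FI Ix]; exact: FK Ix.
Qed.

Lemma sub_ideal_sum F I : F I -> I `<=` ideal_sum F.
Proof. by move=> FI x Ix; apply: finite_sums_incl; exists I. Qed.

Lemma ideal_mulS I I' J J' : I `<=` I' -> J `<=` J' ->
  ideal_mul I J `<=` ideal_mul I' J'.
Proof.
move=> sI sJ; apply: finite_sums_min.
- exact: finite_sums0.
- exact: finite_sumsD.
- by move=> _ [x [y [/sI Ix /sJ Jy ->]]]; exact: mem_ideal_mul.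
Qed.

Lemma ideal_mul_subl I J : is_ideal I -> ideal_mul I J `<=` I.
Proof.
move=> Iid; apply: ideal_mul_min => // x y Ix _; rewrite mulrC.
by case: Iid => _ _; apply.
Qed.

Lemma ideal_mul_subr I J : is_ideal J -> ideal_mul I J `<=` J.
Proof. by move=> Jid; apply: ideal_mul_min => // x y _; case: Jid => _ _; apply. Qed.

Definition is_idem_ideal I : Prop := is_ideal I /\ ideal_mul I I = I.

Lemma is_idem_idealP I :
  is_ideal I -> I `<=` ideal_mul I I -> is_idem_ideal I.
Proof.
by move=> Iid sI; split=> //; apply/seteqP; split=> //; exact: ideal_mul_subl.
Qed.

Lemma is_idem_ideal_mul I J :
  is_idem_ideal I -> is_idem_ideal J -> is_idem_ideal (ideal_mul I J).
Proof.
move=> [Iid II] [Jid JJ]; have IJid := is_ideal_mul J Iid.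
set K := ideal_mul I J.
apply: is_idem_idealP => //; have KKid : is_ideal (ideal_mul K K).
  exact: is_ideal_mul.
have [KK0 KKD _] := KKid.
apply: ideal_mul_min => // x y; rewrite -{1}II => Ix Jy.
move: x Ix; apply: (@finite_sums_min _ [set x | ideal_mul K K (x * y)]) => /=.
- by rewrite mul0r.
- by move=> x x' Kx Kx'; rewrite mulrDl; exact: KKD.
move=> _ [x1 [x2 [Ix1 Ix2 ->]]] /=.
move: Jy; rewrite -{1}JJ; move: y.
apply: (@finite_sums_min _ [set y | ideal_mul K K (x1 * x2 * y)]) => /=.
- by rewrite mulr0.
- by move=> y y' Ky Ky'; rewrite mulrDr; exact: KKD.
move=> _ [y1 [y2 [Jy1 Jy2 ->]]] /=.
by rewrite mulrACA; apply: mem_ideal_mul; exact: mem_ideal_mul.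
Qed.

Lemma is_idem_ideal_sum F :
  (forall I, F I -> is_idem_ideal I) -> is_idem_ideal (ideal_sum F).
Proof.
move=> Fid; have Sid : is_ideal (ideal_sum F).
  by apply: is_ideal_sum => I /Fid[].
apply: is_idem_idealP => //; apply: ideal_sum_min.
  exact: is_ideal_mul.
move=> I FI; have [_ {1}<-] := Fid _ FI.
by apply: ideal_mulS; exact: sub_ideal_sum.
Qed.

Lemma is_idem_ideal1 : is_idem_ideal setT.
Proof.
by apply: is_idem_idealP => // x _; rewrite -[x]mul1r; exact: mem_ideal_mul.
Qed.

(* The boolean reflection makes [IdemIdl] a subtype of [set A], so that two
   elements are equal as soon as they have the same underlying ideal. *)
Record IdemIdl : Type := MkIdemIdl {
  idem_set :> set A;
  _ : `[< is_idem_ideal idem_set >]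
}.

HB.instance Definition _ := [isSub for idem_set].
HB.instance Definition _ := [Choice of IdemIdl by <:].

Implicit Types (X Y Z : IdemIdl) (G : set IdemIdl).

Lemma idem_setP X : is_idem_ideal X.
Proof. by case: X => I /= /asboolP. Qed.

Definition idem_le X Y : bool := `[< X `<=` Y >].

Fact idem_le_refl : reflexive idem_le.
Proof. by move=> X; apply/asboolP. Qed.

Fact idem_le_anti : antisymmetric idem_le.
Proof.
by move=> X Y /andP[/asboolP XY /asboolP YX]; apply/val_inj/seteqP.
Qed.

Fact idem_le_trans : transitive idem_le.
Proof.
move=> Y X Z /asboolP XY /asboolP YZ; apply/asboolP.
exact: subset_trans XY YZ.
Qed.

HB.instance Definition _ := Order.Le_isPOrder.Build set_display IdemIdl
  idem_le_refl idem_le_anti idem_le_trans.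

Definition idem_mul X Y : IdemIdl :=
  MkIdemIdl (asboolT (is_idem_ideal_mul (idem_setP X) (idem_setP Y))).

Fact idem_sum_proof G : is_idem_ideal (ideal_sum (idem_set @` G)).
Proof. by apply: is_idem_ideal_sum => _ [X _ <-]; exact: idem_setP. Qed.

Definition idem_sum G : IdemIdl := MkIdemIdl (asboolT (idem_sum_proof G)).

Definition idem_one : IdemIdl := MkIdemIdl (asboolT is_idem_ideal1).

Fact idem_sum_ub G X : G X -> (X <= idem_sum G)%O.
Proof. by move=> GX; apply/asboolP/sub_ideal_sum; exists X. Qed.

Fact idem_sum_le G Y : (forall X, G X -> (X <= Y)%O) -> (idem_sum G <= Y)%O.
Proof.
move=> GY; apply/asboolP; apply: ideal_sum_min (proj1 (idem_setP Y)) _.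
by move=> _ [X /GY /asboolP sXY <-].
Qed.

Fact idem_mulP X Y Z : (X <= idem_mul Y Z)%O = (X <= Y)%O && (X <= Z)%O.
Proof.
apply/idP/andP => [XYZ|[/asboolP XY /asboolP XZ]].
  have [Yid Zid] := (proj1 (idem_setP Y), proj1 (idem_setP Z)).
  by split; apply: (le_trans XYZ); apply/asboolP;
    [exact: ideal_mul_subl | exact: ideal_mul_subr].
have : ideal_mul X X `<=` ideal_mul Y Z by exact: ideal_mulS.
by have [_ ->] := idem_setP X => XYZ; apply/asboolP.
Qed.

Fact idem_addP X Y Z :
  (idem_sum [set X; Y] <= Z)%O = (X <= Z)%O && (Y <= Z)%O.
Proof.
apply/idP/andP => [XYZ|[XZ YZ]].
  by split; apply: le_trans XYZ; apply: idem_sum_ub; [left|right].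
by apply: idem_sum_le => _ [|] ->.
Qed.

HB.instance Definition _ :=
  Order.POrder_MeetJoin_isLattice.Build set_display IdemIdl idem_mulP idem_addP.

Fact idem_sum0_le X : (idem_sum set0 <= X)%O.
Proof. by apply: idem_sum_le. Qed.

Fact le_idem_one X : (X <= idem_one)%O.
Proof. exact/asboolP. Qed.

HB.instance Definition _ :=
  Order.hasBottom.Build set_display IdemIdl idem_sum0_le.
HB.instance Definition _ := Order.hasTop.Build set_display IdemIdl le_idem_one.

Fact idem_mul_sum X G :
  (X `&` idem_sum G)%O = idem_sum [set (X `&` Y)%O | Y in G].
Proof.
apply/le_anti/andP; split; last first.
  apply: idem_sum_le => _ [Y GY <-].
  by rewrite lexI leIl /= (le_trans (leIr _ _)) // idem_sum_ub.
set S := (X in (_ <= X)%O); have [Sid _] := idem_setP S; have [S0 SD _] := Sid.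
suff XGS : ideal_mul X (ideal_sum (idem_set @` G)) `<=` S by exact/asboolP.
apply: (ideal_mul_min Sid) => x y Xx; move: y.
apply: (@finite_sums_min _ [set y | (S : set A) (x * y)]) => /=.
- by rewrite mulr0.
- by move=> y z Sy Sz; rewrite mulrDr; exact: SD.
move=> y [_ [Y GY <-] Yy] /=.
have /asboolP : (X `&` Y <= S)%O by apply: idem_sum_ub; exists Y.
by apply; exact: mem_ideal_mul.
Qed.

HB.instance Definition _ := TBLattice_isFrame.Build set_display IdemIdl
  idem_sum_ub idem_sum_le idem_mul_sum.

Lemma IdemIdl_leE X Y : (X <= Y)%O = `[< (X : set A) `<=` (Y : set A) >].
Proof. by []. Qed.

Lemma IdemIdl_meetE X Y : idem_set (X `&` Y)%O = ideal_mul X Y.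
Proof. by []. Qed.

Lemma IdemIdl_joinE G : idem_set (frame_join G) = ideal_sum (idem_set @` G).
Proof. by []. Qed.

Lemma IdemIdl_topE : idem_set \top%O = setT.
Proof. by []. Qed.
End Ideals.

(** * Atomless Boolean algebras *)

(* A [ctbDistrLatticeType] may be trivial, i.e. have [\bot = \top]. *)
Definition atom d (B : ctbDistrLatticeType d) (b : B) : Prop :=
  b != \bot%O /\ forall c : B, c != \bot%O -> (c <= b)%O -> c = b.

Definition atomless d (B : ctbDistrLatticeType d) : Prop :=
  forall b : B, ~ atom b.
Arguments atomless {d} B.

(** * The nil-Cantor ring *)

(* [{malg k[B]}] is the free [k]-module on [B]; its elements are the finitely
   supported functions [B -> k], with basis [<< b >>]. *)
Definition nilCantor (k : fieldType) d (B : ctbDistrLatticeType d) : Type :=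
  {malg k[B]}.

HB.instance Definition _ k d (B : ctbDistrLatticeType d) :=
  GRing.Lmodule.copy (nilCantor k B) {malg k[B]}.

Section NilCantor.
Variables (k : fieldType) (d : Order.disp_t) (B : ctbDistrLatticeType d).
Local Notation R := (nilCantor k B).
Implicit Types (x y z : R) (a b c : B) (r : k).

Definition nc_e b : R := << b >>.

Definition nc_emul b c : R :=
  if (b `&` c)%O == \bot%O then nc_e (b `|` c)%O else 0.

Definition nc_mul x y : R :=
  \sum_(b <- msupp x) \sum_(c <- msupp y) (x@_b * y@_c) *: nc_emul b c.

Lemma nc_mulw (D E : {fset B}) x y :
  (msupp x `<=` D)%fset -> (msupp y `<=` E)%fset ->
  nc_mul x y = \sum_(b <- D) \sum_(c <- E) (x@_b * y@_c) *: nc_emul b c.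
Proof.
move=> xD yE; rewrite /nc_mul (big_fset_incl _ xD) /=.
  apply: eq_bigr => b _; apply: big_fset_incl => // c _ /mcoeff_outdom ->.
  by rewrite mulr0 scale0r.
move=> b _ /mcoeff_outdom xb; rewrite big1 // => c _.
by rewrite xb mul0r scale0r.
Qed.

Lemma nc_mulC : commutative nc_mul.
Proof.
move=> x y; rewrite /nc_mul exchange_big /=; apply: eq_bigr => c _.
by apply: eq_bigr => b _; rewrite mulrC /nc_emul meetC joinC.
Qed.

Lemma nc_mulDl : left_distributive nc_mul +%R.
Proof.
move=> x y z.
rewrite [in RHS](nc_mulw (fsubsetUl (msupp x) (msupp y)) (fsubset_refl _)).
rewrite [in RHS](nc_mulw (fsubsetUr (msupp x) (msupp y)) (fsubset_refl _)).
rewrite (nc_mulw (msuppD_le x y) (fsubset_refl _)).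
rewrite -big_split /=; apply: eq_bigr => b _.
rewrite -big_split /=; apply: eq_bigr => c _.
by rewrite mcoeffD mulrDl scalerDl.
Qed.

Lemma nc_mulZl r x y : nc_mul (r *: x) y = r *: nc_mul x y.
Proof.
rewrite (nc_mulw (msuppZ_le r x) (fsubset_refl _)) scaler_sumr.
apply: eq_bigr => b _; rewrite scaler_sumr; apply: eq_bigr => c _.
by rewrite mcoeffZ -mulrA scalerA.
Qed.

Lemma nc_mulDr : right_distributive nc_mul +%R.
Proof. by move=> x y z; rewrite nc_mulC nc_mulDl !(nc_mulC x). Qed.

Lemma nc_mulZr r x y : nc_mul x (r *: y) = r *: nc_mul x y.
Proof. by rewrite nc_mulC nc_mulZl nc_mulC. Qed.

Lemma nc_mul0l y : nc_mul 0 y = 0.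
Proof. by rewrite -(scale0r (0 : R)) nc_mulZl !scale0r. Qed.

Lemma nc_mul0r x : nc_mul x 0 = 0.
Proof. by rewrite nc_mulC nc_mul0l. Qed.

Lemma nc_mul_e b c : nc_mul (nc_e b) (nc_e c) = nc_emul b c.
Proof.
by rewrite /nc_mul !msuppU oner_eq0 !big_seq_fset1 !mcoeffUU mulr1 scale1r.
Qed.

Lemma nc_basisE x : x = \sum_(b <- msupp x) x@_b *: nc_e b.
Proof.
rewrite [LHS]monalgE; apply: eq_bigr => b _.
by apply/malgP => c; rewrite mcoeffZ !mcoeffU mulrnAr mulr1.
Qed.

Lemma nc_linear_ind (P : R -> Prop) :
  P 0 -> (forall x y, P x -> P y -> P (x + y)) ->
  (forall r x, P x -> P (r *: x)) -> (forall b, P (nc_e b)) -> forall x, P x.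
Proof.
move=> P0 PD PZ Pe x; rewrite [x]nc_basisE.
by elim/big_ind: _ => // b _; exact: PZ.
Qed.

Lemma nc_mulA : associative nc_mul.
Proof.
move=> x y z; elim/nc_linear_ind: x => [|x x' Hx Hx'|r x Hx|a].
- by rewrite !nc_mul0l.
- by rewrite !nc_mulDl Hx Hx'.
- by rewrite !nc_mulZl Hx.
elim/nc_linear_ind: y => [|y y' Hy Hy'|r y Hy|b].
- by rewrite !(nc_mul0l, nc_mul0r).
- by rewrite !(nc_mulDl, nc_mulDr) Hy Hy'.
- by rewrite !(nc_mulZl, nc_mulZr) Hy.
elim/nc_linear_ind: z => [|z z' Hz Hz'|r z Hz|c].
- by rewrite !nc_mul0r.
- by rewrite !nc_mulDr Hz Hz'.
- by rewrite !nc_mulZr Hz.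
rewrite !nc_mul_e /nc_emul.
case: (eqVneq (b `&` c)%O) => [bc|bc].
  case: (eqVneq (a `&` b)%O) => [ab|ab]; rewrite ?nc_mul0l !nc_mul_e /nc_emul.
    by rewrite meetUr meetUl ab bc join0x joinx0 joinA.
  by rewrite meetUr join_eq0 (negbTE ab).
rewrite nc_mul0r; case: ifP => // _; last by rewrite nc_mul0l.
by rewrite nc_mul_e /nc_emul meetUl join_eq0 (negbTE bc) andbF.
Qed.

Lemma nc_mul1l : left_id (nc_e \bot%O) nc_mul.
Proof.
move=> x; elim/nc_linear_ind: x => [|x x' Hx Hx'|r x Hx|a].
- by rewrite nc_mul0r.
- by rewrite nc_mulDr Hx Hx'.
- by rewrite nc_mulZr Hx.
by rewrite nc_mul_e /nc_emul meet0x eqxx join0x.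
Qed.

Lemma nc_e0_neq0 : nc_e \bot%O != 0.
Proof. by rewrite /nc_e monalgU_eq0 oner_eq0. Qed.

HB.instance Definition _ := GRing.Zmodule_isComNzRing.Build R
  nc_mulA nc_mulC nc_mul1l nc_mulDl nc_e0_neq0.

Fact nc_scalerAl r x y : r *: (x * y) = (r *: x) * y.
Proof. by rewrite [RHS]nc_mulZl. Qed.

HB.instance Definition _ := GRing.Lmodule_isLalgebra.Build k R nc_scalerAl.
HB.instance Definition _ := GRing.Lalgebra_isComAlgebra.Build k R.

Lemma nc_eM b c :
  nc_e b * nc_e c = if (b `&` c)%O == \bot%O then nc_e (b `|` c)%O else 0.
Proof. exact: nc_mul_e. Qed.

Lemma nc_e0 : nc_e \bot%O = 1.
Proof. by []. Qed.
End NilCantor.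

(* Main.v *)
Require Import Defs.
From mathcomp Require Import all_boot all_order all_algebra.
From mathcomp Require Import boolp classical_sets functions cardinality.
From mathcomp Require Import monalg.
Import Order.TTheory Order.CTheory GRing.Theory.
Local Open Scope classical_set_scope.
Local Open Scope ring_scope.
Local Open Scope card_scope.

Set Implicit Arguments.
Unset Strict Implicit.
Unset Printing Implicit Defensive.

(** Write [R] for the nil-Cantor ring.  A set [G] of elements of [B] in which
    every member is a disjoint join [g1 `|` g2] of two members generates an
    idempotent ideal, because [e g = e g1 * e g2].  Atomlessness provides many
    such [G].  Taking all nonzero elements below [b] gives ideals that determine
    [b] (the multiples of [e g] are supported on elements above [g]), whence the
    bound on the cardinality.  For [b = \top] this is an idempotent ideal [m]
    spanned by the [e g], [g != \bot], all of square zero; every element of [R]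
    is a scalar plus an element of [m], so [R] is local with maximal ideal [m],
    and sending [I] to the truth value of [1 \in I] is a point.

    This is the only point.  All proper ideals lie in [m], so it suffices that
    a point [p] vanishes at [m].  Let [N] be the join of all idempotent ideals
    killed by [p]; then [p N] is false, and [m <= N] has to be shown, that is
    [e c \in N] for every [c != \bot].  The element [e c] lies in two
    idempotent ideals [I] and [J] with [I * J = 0] ([orthogonal_idem_ideals]).
    Since [p (I `&` J)] is then false, [p] kills [I] or [J], and [N] contains
    that ideal.

    To obtain [I] and [J], split [c] repeatedly into two nonzero halves.  This
    transports the clopen subsets of the Cantor space of binary sequences to
    elements below [c].  Let [I] be generated by the cylinders that constrain only
    the odd coordinates and [J] by those that constrain only the even ones.
    Constraining one further coordinate splits a cylinder, so both ideals are
    idempotent; a cylinder of the first kind always meets one of the second, so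
    all products [e g * e h] of generators vanish.

    The point takes the value false at [m]; hence, if [\bot != \top] in [B], no
    point separates the nonzero ideal [m] from the zero ideal. *)

(** * Cantor schemes in an atomless Boolean algebra *)

Section CantorScheme.
Variables (d : Order.disp_t) (B : ctbDistrLatticeType d).
Implicit Types (b c : B) (s : bool -> B -> B) (w : seq (option bool)).

Definition splitting s : Prop := forall b, b != \bot%O ->
  [/\ forall x, s x b != \bot%O,
      (s true b `&` s false b)%O = \bot%O
    & (s true b `|` s false b)%O = b].

Lemma atomless_splitting : atomless B -> exists s, splitting s.
Proof.
move=> Bal.
have /choice[f fP] : forall b, exists lr : B * B, b != \bot%O ->
    [/\ lr.1 != \bot%O, lr.2 != \bot%O, (lr.1 `&` lr.2)%O = \bot%O
      & (lr.1 `|` lr.2)%O = b].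
  move=> b; have [b0|b0] := eqVneq b \bot%O; first by exists (b, b).
  have [c [c0 cb cNb]] : exists c, [/\ c != \bot%O, (c <= b)%O & c != b].
    apply: contra_notP (Bal b) => /forallNP Nc; split=> // c c0 cb.
    by apply/eqP/negP => /negP cNb; apply: (Nc c).
  exists (c, b `\` c)%O => _; split=> //=.
  - by rewrite diff_eq0; apply: contra cNb => bc; rewrite eq_le cb bc.
  - exact: diffKI.
  - exact: leBKU.
exists (fun x b => if x then (f b).1 else (f b).2) => b /fP[*].
by split=> // -[].
Qed.

Section Cylinders.
Variables (s : bool -> B -> B) (sP : splitting s).

(** The element below [b] that corresponds to the set of binary sequences
    matching the pattern [w]: [Some x] prescribes the coordinate [x], while
    [None], like every position beyond the end of [w], leaves it free. *)
Fixpoint cylinder b w : B :=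
  match w with
  | [::] => b
  | Some x :: w' => cylinder (s x b) w'
  | None :: w' => cylinder (s true b) w' `|` cylinder (s false b) w'
  end%O.

Lemma splitting_neq0 x b : b != \bot%O -> s x b != \bot%O.
Proof. by case/sP. Qed.

Lemma splitting_le x b : b != \bot%O -> (s x b <= b)%O.
Proof.
by case/sP=> _ _ {2}<-; case: x; rewrite (leUl, leUr).
Qed.

Lemma cylinder_le b w : b != \bot%O -> (cylinder b w <= b)%O.
Proof.
elim: w b => //= -[x|] w IH b b0.
  by rewrite (le_trans (IH _ _)) ?splitting_le //; exact: splitting_neq0.
by rewrite leUx !(le_trans (IH _ _)) ?splitting_le //; exact: splitting_neq0.
Qed.

Lemma cylinder_neq0 b w : b != \bot%O -> cylinder b w != \bot%O.
Proof.
elim: w b => //= -[x|] w IH b b0; first exact/IH/splitting_neq0.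
by rewrite join_eq0 negb_and IH //; exact: splitting_neq0.
Qed.

(** A free coordinate joins the two halves together again.  Padding with it
    adjusts the parity of the length of a pattern. *)
Lemma cylinder_rcons_None b w :
  b != \bot%O -> cylinder b (rcons w None) = cylinder b w.
Proof.
elim: w b => /= [|[x|] w IH] b b0; first by case: (sP b0).
  exact/IH/splitting_neq0.
by rewrite !IH //; exact: splitting_neq0.
Qed.

Lemma cylinder_split b w : b != \bot%O ->
  (cylinder b (rcons w (Some true)) `&` cylinder b (rcons w (Some false)))%O
    = \bot%O
  /\ (cylinder b (rcons w (Some true))
      `|` cylinder b (rcons w (Some false)))%O = cylinder b w.
Proof.
elim: w b => /= [|[x|] w IH] b b0; first by case: (sP b0).
  exact/IH/splitting_neq0.
have st := splitting_neq0 true b0; have sf := splitting_neq0 false b0.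
have [dt jt] := IH _ st; have [df jf] := IH _ sf.
split; last by rewrite joinACA jt jf.
have dtf w1 w2 :
    (cylinder (s true b) w1 `&` cylinder (s false b) w2)%O = \bot%O.
  apply/eqP; rewrite -lex0; have [_ <- _] := sP b0.
  by rewrite leI2 ?cylinder_le.
by rewrite meetUl !meetUr dt df dtf meetC dtf !joinx0.
Qed.

(** Some binary sequence matches both patterns, as no coordinate is prescribed
    twice.  The induction follows such a sequence, going into a half of [b]
    that both first symbols allow. *)
Lemma cylinder_meet_neq0 b w w' : b != \bot%O ->
  (forall i, nth None w i = None \/ nth None w' i = None) ->
  (cylinder b w `&` cylinder b w')%O != \bot%O.
Proof.
elim: w b w' => [|o w IH] b [|o' w'] b0 ww'.
- by rewrite meetxx.
- by rewrite (meet_r (cylinder_le _ b0)) cylinder_neq0.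
- by rewrite (meet_l (cylinder_le _ b0)) cylinder_neq0.
have /= tl i := ww' i.+1.
have Nle x v : (cylinder (s x b) v <= cylinder b (None :: v))%O.
  by case: x => /=; rewrite (leUl, leUr).
have step x : (cylinder (s x b) w <= cylinder b (o :: w))%O ->
    (cylinder (s x b) w' <= cylinder b (o' :: w'))%O ->
    (cylinder b (o :: w) `&` cylinder b (o' :: w'))%O != \bot%O.
  move=> le1 le2.
  apply: contra (IH _ _ (splitting_neq0 x b0) tl).
  by rewrite -!lex0; apply: le_trans; exact: leI2.
case: o o' ww' step => [x|] [y|] ww' step.
- by case: (ww' 0).
- exact: (step x).
- exact: (step y).
- exact: (step true).
Qed.

Definition parity_cylinders (q : bool) b : set B :=
  [set cylinder b w | w in
    [set w | forall i, odd i != q -> nth None w i = None]].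

Lemma parity_cylinders_top q b : parity_cylinders q b b.
Proof. by exists [::] => // i _; rewrite nth_nil. Qed.

Lemma parity_cylinders_meet b : b != \bot%O -> forall g h,
  parity_cylinders true b g -> parity_cylinders false b h ->
  (g `&` h)%O != \bot%O.
Proof.
move=> b0 _ _ [w wP <-] [w' w'P <-]; apply: cylinder_meet_neq0 => // i.
by case i_odd: (odd i); [right; apply: w'P | left; apply: wP]; rewrite i_odd.
Qed.

Lemma parity_cylinders_split q b : b != \bot%O -> forall g,
  parity_cylinders q b g -> exists g1 g2,
  [/\ parity_cylinders q b g1, parity_cylinders q b g2,
      (g1 `&` g2)%O = \bot%O & (g1 `|` g2)%O = g].
Proof.
move=> b0 _ [w wP <-].
(* The next coordinate has index [size w]; it may be prescribed only if its
   parity is [q]. *)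
wlog szw : w wP / odd (size w) = q => [H|].
  have [|szw] := eqVneq (odd (size w)) q; first exact: H.
  rewrite -(cylinder_rcons_None w b0); apply: H => [i /wP wi|].
    by rewrite nth_rcons wi !if_same.
  by rewrite size_rcons /=; case: (odd _) q szw {wP} => -[].
have [dj jn] := cylinder_split w b0.
have mem x : parity_cylinders q b (cylinder b (rcons w (Some x))).
  exists (rcons w (Some x)) => // i iq; rewrite nth_rcons wP //.
  have /negbTE -> : i != size w by apply: contraNneq iq => ->; rewrite szw.
  by rewrite if_same.
exists (cylinder b (rcons w (Some true))).
by exists (cylinder b (rcons w (Some false))).
Qed.

End Cylinders.
End CantorScheme.

(** * Points of a frame *)

Section FramePoints.
Variables (d : Order.disp_t) (L : frameType d) (p : L -> bool).
Hypothesis pP : pt L p.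

Lemma pt_le x y : (x <= y)%O -> p x -> p y.
Proof.
have [_ pI _] := pP.
by move=> /meet_idPl xy; rewrite -{1}xy pI => /andP[].
Qed.

Lemma pt_join_false (S : set L) :
  (forall x, S x -> p x = false) -> p (frame_join S) = false.
Proof.
have [_ _ ->] := pP => S0.
have : (frame_join (p @` S) <= false)%O.
  by apply: frame_join_le => _ [x /S0 px <-]; rewrite px.
by case: (frame_join _).
Qed.

Lemma pt_bot : p \bot%O = false.
Proof.
apply/negbTE/negP => /(pt_le (le0x (frame_join (set0 : set L)))).
by rewrite pt_join_false.
Qed.
End FramePoints.

(** * Ideals of the nil-Cantor ring generated by basis elements *)

Section NilCantorIdeals.
Variables (k : fieldType) (d : Order.disp_t) (B : ctbDistrLatticeType d).
Local Notation R := (nilCantor k B).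
Local Notation e := (@nc_e k d B).
Implicit Types (x y z : R) (b c g : B) (G H : set B) (I J : IdemIdl R).

Definition basis_ideal G : set R := ideal_mul setT (e @` G).

Lemma is_ideal_basis_ideal G : is_ideal (basis_ideal G).
Proof. by apply: is_ideal_mul; split. Qed.

Lemma mem_basis_ideal G g : G g -> basis_ideal G (e g).
Proof.
by move=> Gg; rewrite -[e g]mul1r; apply: mem_ideal_mul => //; exists g.
Qed.

Lemma basis_ideal_min G (T : set R) : is_ideal T ->
  (forall g, G g -> T (e g)) -> basis_ideal G `<=` T.
Proof.
move=> Tid GT; apply: ideal_mul_min => // x _ _ [g Gg <-].
by have [_ _] := Tid; apply; exact: GT.
Qed.

Lemma basis_ideal_idem G :
  (forall g, G g -> exists g1 g2,
    [/\ G g1, G g2, (g1 `&` g2)%O = \bot%O & (g1 `|` g2)%O = g]) ->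
  is_idem_ideal (basis_ideal G).
Proof.
move=> Gsplit; apply: is_idem_idealP; first exact: is_ideal_basis_ideal.
apply: basis_ideal_min; first exact/is_ideal_mul/is_ideal_basis_ideal.
move=> g /Gsplit[g1 [g2 [Gg1 Gg2 dj <-]]].
have -> : e (g1 `|` g2)%O = e g1 * e g2 by rewrite nc_eM dj eqxx.
by apply: mem_ideal_mul; exact: mem_basis_ideal.
Qed.

(** Basis elements with overlapping indices annihilate each other. *)
Lemma basis_ideal_mul0 G H :
  (forall g h, G g -> H h -> (g `&` h)%O != \bot%O) ->
  ideal_mul (basis_ideal G) (basis_ideal H) `<=` [set 0].
Proof.
move=> GH; apply: ideal_mul_min.
  by split=> // [x y -> ->|a x ->]; rewrite ?addr0 ?mulr0.
move=> x y Gx Hy; move: x Gx.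
apply: (basis_ideal_min (T := [set x | x * y = 0])) => /=.
  split=> /= [|x x' xy x'y|a x xy]; first by rewrite mul0r.
    by rewrite mulrDl xy x'y addr0.
  by rewrite -mulrA xy mulr0.
move=> g Gg; move: y Hy.
apply: (basis_ideal_min (T := [set y | e g * y = 0])) => /=.
  split=> /= [|y y' xy xy'|a y xy]; first by rewrite mulr0.
    by rewrite mulrDr xy xy' addr0.
  by rewrite mulrCA xy mulr0.
by move=> h Hh; rewrite nc_eM (negbTE (GH _ _ Gg Hh)).
Qed.

Lemma coef_e b c : (e b)@_c = (b == c)%:R.
Proof. by rewrite mcoeffU. Qed.

(** Multiplying by [e g] turns an index [b] into [b `|` g], or gives zero. *)
Lemma coef_mul_e x g c : ~~ (g <= c)%O -> (x * e g)@_c = 0.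
Proof.
move=> gc; elim/nc_linear_ind: x => [|x y Hx Hy|r x Hx|b].
- by rewrite mul0r mcoeff0.
- by rewrite mulrDl mcoeffD Hx Hy addr0.
- by rewrite -scalerAl mcoeffZ Hx mulr0.
rewrite nc_eM; case: ifP => _; last by rewrite mcoeff0.
rewrite coef_e; case: eqP => // bgc.
by move: gc; rewrite -bgc leUr.
Qed.

Lemma coef_basis_ideal G c : (forall g, G g -> ~~ (g <= c)%O) ->
  forall x, basis_ideal G x -> x@_c = 0.
Proof.
move=> Gc; apply: finite_sums_min => /= [|x y x0 y0|].
- by rewrite mcoeff0.
- by rewrite mcoeffD x0 y0 addr0.
- by move=> _ [x [_ [_ [g /Gc gc <-] ->]]] /=; exact: coef_mul_e.
Qed.

Definition below b : set B := [set g | g != \bot%O /\ (g <= b)%O].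

Lemma below_top g : g != \bot%O -> below \top%O g.
Proof. by move=> g0; split=> //; exact: lex1. Qed.

(** If [b `\` c] were nonzero, then [e (b `\` c)] would lie in the first ideal;
    but no nonzero element below [c] is below [b `\` c], so this basis element
    does not occur in the second ideal. *)
Lemma basis_ideal_below_le b c :
  basis_ideal (below b) `<=` basis_ideal (below c) -> (b <= c)%O.
Proof.
move=> bc; rewrite -diff_eq0; apply: contraT => g0.
have /bc /coef_basis_ideal gc : basis_ideal (below b) (e (b `\` c)%O).
  by apply: mem_basis_ideal; split=> //; exact: leBx.
have/eqP := coef_e (b `\` c)%O (b `\` c)%O.
rewrite eqxx gc ?(eq_sym 0) ?oner_eq0 // => h [h0 hc]; apply: contra h0 => hbc.
by rewrite -lex0 -(diffKI b c) lexI hc.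
Qed.

(** * The maximal ideal and the point that it defines *)

Local Notation m := (basis_ideal (below \top%O)).

Lemma one_notin_maxideal : ~ m 1.
Proof.
move=> m1; have/eqP : (1 : R)@_\bot%O = 0.
  by apply: coef_basis_ideal m1 => g [g0 _]; rewrite lex0.
by rewrite -nc_e0 coef_e eqxx oner_eq0.
Qed.

Lemma sub_const_mem_maxideal x : m (x - x@_\bot%O *: 1).
Proof.
have [m0 mD mM] := is_ideal_basis_ideal (below \top%O).
elim/nc_linear_ind: x => [|x y Hx Hy|r x Hx|b].
- by rewrite mcoeff0 scale0r subr0.
- by rewrite mcoeffD scalerDl opprD addrACA; exact: mD.
- by rewrite mcoeffZ -scalerA -scalerBr -[_ - _]mul1r scalerAl; exact: mM.
rewrite coef_e; have [->|b0] := eqVneq b \bot%O.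
  by rewrite scale1r nc_e0 subrr.
by rewrite scale0r subr0; exact/mem_basis_ideal/below_top.
Qed.

(** The multiples of [e g], [g != \bot], have square zero, and [u + n] divides
    the invertible [u * u = (u - n) * (u + n)] when [n * n = 0].  Quantifying
    over [u] inside the claim makes it pass from [y] and [y'] to [y + y']. *)
Lemma add_maxideal_invertible y : m y ->
  forall u, (exists v, v * u = 1) -> exists v, v * (u + y) = 1.
Proof.
move: y; apply: finite_sums_min => /= [u|y y' Hy Hy' u /Hy /Hy'|].
- by rewrite addr0.
- by rewrite addrA.
move=> _ [x [_ [_ [g [g0 _] <-] ->]]] /= u [v vu].
have n0 : (x * e g) * (x * e g) = 0.
  by rewrite mulrACA nc_eM meetxx (negbTE g0) mulr0.
exists (v * v * (u - x * e g)).
by rewrite -mulrA -subr_sqr !expr2 n0 subr0 mulrACA vu mulr1.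
Qed.

Lemma proper_sub_maxideal (I : set R) : is_ideal I -> ~ I 1 -> I `<=` m.
Proof.
move=> [_ _ IM] I1 x Ix; have mx := sub_const_mem_maxideal x.
have [x0|x0] := eqVneq (x@_\bot%O) 0; first by rewrite x0 scale0r subr0 in mx.
case: I1; have [|v <-] := add_maxideal_invertible mx (u := x@_\bot%O *: 1).
  exists ((x@_\bot%O)^-1 *: 1).
  by rewrite -scalerAl mul1r scalerA mulVf // scale1r.
by rewrite addrC subrK; exact: IM.
Qed.

Definition unit_ideal_pt I : bool := `[< (I : set R) 1 >].

(** Joins are preserved because the ring is local: a sum of proper ideals stays
    inside the maximal ideal. *)
Lemma unit_ideal_pt_point : pt (IdemIdl R) unit_ideal_pt.
Proof.
split=> [|I J|F]; rewrite /unit_ideal_pt.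
- exact/asboolP.
- rewrite IdemIdl_meetE; apply/asboolP/andP => [IJ1|[/asboolP I1 /asboolP J1]].
    by split; apply/asboolP;
      [apply: ideal_mul_subl IJ1 | apply: ideal_mul_subr IJ1];
      exact: proj1 (idem_setP _).
  by rewrite -[1]mulr1; exact: mem_ideal_mul.
- rewrite IdemIdl_joinE; apply/asboolP/asboolP => [F1|[I FI /asboolP I1]].
    apply: contrapT => NF; apply: one_notin_maxideal.
    apply: ideal_sum_min F1; first exact: is_ideal_basis_ideal.
    move=> _ [I FI <-]; apply: proper_sub_maxideal; first by case: (idem_setP I).
    by move=> I1; apply: NF; exists I => //; exact/asboolP.
  by apply: sub_ideal_sum I1; exists I.
Qed.

(** * Uniqueness of the point *)

Section Atomless.
Hypothesis Bal : atomless B.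

Lemma below_idem b : is_idem_ideal (basis_ideal (below b)).
Proof.
apply: basis_ideal_idem => g [g0 gb]; have [s sP] := atomless_splitting Bal.
have [s0 dj jn] := sP _ g0.
exists (s true g), (s false g); split=> //; split=> //;
  exact: le_trans (splitting_le sP _ g0) gb.
Qed.

Definition below_ideal b : IdemIdl R := MkIdemIdl (asboolT (below_idem b)).

Lemma below_ideal_inj : injective below_ideal.
Proof.
move=> b c /(congr1 (@idem_set _)) /= bc; apply/le_anti.
by rewrite !basis_ideal_below_le // bc.
Qed.

(** This is where the independence of the even and the odd coordinates of a
    Cantor scheme enters; it forces every point to kill an idempotent ideal
    that contains [e c]. *)
Lemma orthogonal_idem_ideals c : c != \bot%O -> exists I J,
  [/\ (I : set R) (e c), (J : set R) (e c) & (I `&` J)%O = \bot%O].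
Proof.
move=> c0; have [s sP] := atomless_splitting Bal.
have idem q := basis_ideal_idem (parity_cylinders_split sP (q := q) c0).
exists (MkIdemIdl (asboolT (idem true))), (MkIdemIdl (asboolT (idem false))).
split; [exact/mem_basis_ideal/parity_cylinders_top..|].
apply/eqP; rewrite -lex0; apply/asboolP; rewrite IdemIdl_meetE.
apply: subset_trans (basis_ideal_mul0 (parity_cylinders_meet sP c0)) _.
by move=> _ ->; have [[]] := idem_setP (\bot%O : IdemIdl R).
Qed.

(** The largest idempotent ideal [N] killed by [p] contains each [e c] with
    [c != \bot], as [p] kills one of two orthogonal ideals containing [e c]. *)
Lemma pt_maxideal_false p : pt (IdemIdl R) p -> p (below_ideal \top%O) = false.
Proof.
move=> pP; pose N := frame_join [set I | p I = false].
have pN : p N = false by exact: pt_join_false.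
apply: contraFF pN; apply: (pt_le pP); apply/asboolP.
apply: basis_ideal_min; first by case: (idem_setP N).
move=> c [c0 _]; have [I [J [Ic Jc IJ0]]] := orthogonal_idem_ideals c0.
have inN K : p K = false -> (K : set R) (e c) -> (N : set R) (e c).
  move=> pK Kc; have /asboolP : (K <= N)%O by exact: frame_join_ub.
  exact.
have [_ pI _] := pP; have := pI I J; rewrite IJ0 (pt_bot pP).
case pIE: (p I); last by move=> _; exact: inN Ic.
by case pJE: (p J) => // _; exact: inN Jc.
Qed.

Lemma pt_unique p : pt (IdemIdl R) p -> p = unit_ideal_pt.
Proof.
move=> pP; apply/funext => I; rewrite /unit_ideal_pt.
case: asboolP => [I1|I1].
  have [pT _ _] := pP; have : p \top%O by rewrite pT.
  apply: (pt_le pP); apply/asboolP => x _; rewrite -[x]mulr1.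
  by have [[_ _ +] _] := idem_setP I; apply.
apply: contraFF (pt_maxideal_false pP); apply: (pt_le pP); apply/asboolP.
by apply: proper_sub_maxideal => //; case: (idem_setP I).
Qed.

End Atomless.
End NilCantorIdeals.

Theorem theoremC (k : fieldType) (d : Order.disp_t) (B : ctbDistrLatticeType d) :
  atomless B ->
  [/\ [set: IdemIdl (nilCantor k B)] #>= [set: B],
      exists p : IdemIdl (nilCantor k B) -> bool,
        pt (IdemIdl (nilCantor k B)) = [set p]
    & \bot%O != \top%O :> B -> ~ spatial (IdemIdl (nilCantor k B))].
Proof.
move=> Bal; split.
- rewrite -(preimage_setT (below_ideal k Bal)).
  by apply: card_ge_preimage => b c _ _; exact: below_ideal_inj.
- exists (@unit_ideal_pt k d B); apply/seteqP; split=> [p|p ->].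
    exact: pt_unique.
  exact: unit_ideal_pt_point.
- move=> B01 /(_ (below_ideal k Bal \top%O) (below_ideal k Bal \bot%O)) [].
    apply/negP => /asboolP /basis_ideal_below_le.
    by rewrite lex0 eq_sym (negbTE B01).
  by move=> p [/(pt_maxideal_false Bal) ->].
Qed.
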